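(* Let $x,\hat x:(I,\frac{ds^2}{m})\to\mathbb{C}$ be a Darboux pair with parameter $\mu$, where $\frac{ds^2}{m}$ is the arc-length polarization of $x$. Then $\frac{ds^2}{m}$ is also the arc-length polarization of $\hat x$ if and only if $|\hat x-x|^2=\frac1\mu$ at one point $s_0\in I$.
   Context: $I\subset\mathbb{R}$ is an interval with parameter $s$, and $'$ denotes $\frac{d}{ds}$. A polarized curve $x:(I,\frac{ds^2}{m})\to\mathbb{C}$ is a smooth curve $x:I\to\mathbb{C}$ together with the non-vanishing quadratic differential $\frac{ds^2}{m}$, where $m:I\to\mathbb{R}^\times$. For a constant $\mu\in\mathbb{R}^\times$, two polarized curves $x,\hat x:(I,\frac{ds^2}{m})\to\mathbb{C}$ are a Darboux pair with parameter $\mu$ if $\frac{x'\hat x'}{(x-\hat x)^2}ds^2=\frac{\mu}{m}ds^2$ (complex multiplication). The differential $\frac{ds^2}{m}$ is the arc-length polarization of $x$ if $\frac{ds^2}{m}=|dx|^2$, i.e. $\frac1m=|x'|^2$ on $I$.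
   Formalization: Adds the hypothesis that it is not the case that both μ < 0 and x̂ is a translate of x; without it the claim fails, e.g. x(s)=s, x̂(s)=s+i, m=1, μ=−1, where both are arc-length polarized but |x̂−x|²=1≠1/μ. *)

(* Defs.v *)
From Stdlib Require Import Reals Lra.
From Coquelicot Require Import Coquelicot.
Open Scope R_scope.

(* Intervals may be open, closed or half-open, bounded or not; a single point
   is excluded, since derivatives with respect to the parameter must make
   sense. *)
Definition is_interval (I : R -> Prop) : Prop :=
  is_connected I /\ exists a b : R, I a /\ I b /\ a < b.

(* Same shape as Coquelicot's [is_derive], with [locally s] restricted to [I]:
   the usual derivative at interior points of [I], the one-sided derivative at
   an end point belonging to [I].  Values of [x] outside [I] are irrelevant. *)
Definition is_derive_on (I : R -> Prop) (x : R -> C) (s : R) (l : C) : Prop :=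
  @filterdiff R_AbsRing R_NormedModule C_R_NormedModule
    x (within I (locally s)) (fun h : R => @scal R_AbsRing C_R_NormedModule h l).

Definition ex_derive_on (I : R -> Prop) (x : R -> C) (s : R) : Prop :=
  exists l : C, is_derive_on I x s l.

Definition Derive_on (I : R -> Prop) (x : R -> C) (s : R) : C :=
  @iota C_R_CompleteNormedModule (is_derive_on I x s).

Lemma is_interval_near (I : R -> Prop) (s : R) (d : posreal) :
  is_interval I -> I s -> exists t : R, I t /\ t <> s /\ Rabs (t - s) < d.
Proof.
  intros [hc [a [b [ha [hb hab]]]]] hs.
  assert (hd := cond_pos d).
  destruct (Rlt_le_dec s b) as [hsb | hbs].
  - exists (Rmin b (s + d / 2)).
    assert (h1 := Rmin_l b (s + d / 2)). assert (h2 := Rmin_r b (s + d / 2)).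
    assert (h3 : s < Rmin b (s + d / 2)) by (apply Rmin_glb_lt; lra).
    split; [apply (hc s b); auto; lra | split; [lra |]].
    rewrite Rabs_right; lra.
  - exists (Rmax a (s - d / 2)).
    assert (h1 := Rmax_l a (s - d / 2)). assert (h2 := Rmax_r a (s - d / 2)).
    assert (h3 : Rmax a (s - d / 2) < s) by (apply Rmax_lub_lt; lra).
    split; [apply (hc a s); auto; lra | split; [lra |]].
    rewrite Rabs_left; lra.
Qed.

Lemma is_derive_on_unique (I : R -> Prop) (x : R -> C) (s : R) (l1 l2 : C) :
  is_interval I -> I s ->
  is_derive_on I x s l1 -> is_derive_on I x s l2 -> l1 = l2.
Proof.
  intros hI hs [_ h1] [_ h2].
  assert (hlim : @is_filter_lim R_UniformSpace (within I (locally s)) s).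
  { intros P hP; unfold within; revert hP; apply filter_imp; auto. }
  specialize (h1 s hlim); specialize (h2 s hlim).
  destruct (Ceq_dec l1 l2) as [e | ne]; [exact e | exfalso].
  assert (hn : 0 < Cmod (l1 - l2)).
  { apply Cmod_gt_0; intros h; apply ne.
    replace l1 with (l1 - l2 + l2)%C by ring; rewrite h; ring. }
  assert (he : 0 < Cmod (l1 - l2) / 4) by lra.
  set (e := mkposreal _ he).
  generalize (filter_and _ _ (h1 e) (h2 e)); unfold within; intros [d hd].
  destruct (is_interval_near I s d hI hs) as [t [ht [hts htd]]].
  destruct (hd t htd ht) as [b1 b2].
  rewrite <- !Cmod_norm in b1, b2.
  change (norm (minus t s)) with (Rabs (t - s)) in b1, b2.
  simpl in b1, b2.
  assert (hp : 0 < Rabs (t - s)) by (apply Rabs_pos_lt; lra).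
  match type of b1 with Cmod ?u <= _ =>
    match type of b2 with Cmod ?v <= _ =>
      assert (hk : (RtoC (t - s) * (l1 - l2))%C = (v + - u)%C);
        [| assert (htri := Cmod_triangle v (- u)%C);
           rewrite Cmod_opp, <- hk, Cmod_mult, Cmod_R in htri; nra ]
    end
  end.
  destruct l1, l2, (x t), (x s).
  unfold minus, plus, opp, scal, Cmult, Cplus, Cminus, Copp, RtoC; simpl.
  unfold mult, plus, opp, scal; simpl.
  unfold mult, plus, opp; simpl.
  f_equal; ring.
Qed.

Lemma Derive_on_unique (I : R -> Prop) (x : R -> C) (s : R) (l : C) :
  is_interval I -> I s -> is_derive_on I x s l -> Derive_on I x s = l.
Proof.
  intros hI hs h.
  apply (@iota_unique R_AbsRing C_R_CompleteNormedModule); [| exact h].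
  intros y hy; exact (is_derive_on_unique I x s y l hI hs hy h).
Qed.

Fixpoint Derive_n_on (I : R -> Prop) (x : R -> C) (n : nat) : R -> C :=
  match n with
  | O => x
  | S k => Derive_on I (Derive_n_on I x k)
  end.

Definition smooth_on (I : R -> Prop) (x : R -> C) : Prop :=
  forall (n : nat) (s : R), I s -> ex_derive_on I (Derive_n_on I x n) s.

(* The quadratic differential ds^2/m is represented by the function [m]. *)
Definition polarized_curve (I : R -> Prop) (m : R -> R) (x : R -> C) : Prop :=
  smooth_on I x /\ forall s : R, I s -> m s <> 0.

(* The division by (x - xhat)^2 presupposes x <> xhat; as division is total
   here, this is stated separately. *)
Definition Darboux_pair (I : R -> Prop) (m : R -> R) (mu : R)
    (x xhat : R -> C) : Prop :=
  polarized_curve I m x /\ polarized_curve I m xhat /\ mu <> 0 /\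
  forall s : R, I s ->
    x s <> xhat s /\
    (Derive_on I x s * Derive_on I xhat s
       / ((x s - xhat s) * (x s - xhat s)))%C = RtoC (mu / m s).

Definition arc_length_polarization (I : R -> Prop) (m : R -> R) (x : R -> C)
  : Prop :=
  forall s : R, I s -> 1 / m s = Cmod (Derive_on I x s) ^ 2.

Definition translate_on (I : R -> Prop) (x xhat : R -> C) : Prop :=
  exists c : C, forall s : R, I s -> xhat s = (x s + c)%C.

(* Main.v *)
Require Import Defs.
From Stdlib Require Import Reals Lra.
From Coquelicot Require Import Coquelicot.
Open Scope R_scope.

(** Write [v = x - xhat].  Since [1/m = |x'|^2 = x' * conj x'], cancelling [x']
    in the Darboux equation leaves [xhat' = mu * conj x' * v^2]
    ([Darboux_derivative]), so that [|xhat'|^2 = (mu * |v|^2)^2 / m].  Hence [m]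
    is the arc-length polarization of [xhat] exactly when [|mu| * |v|^2 = 1]
    along the whole curve ([Darboux_speed]).

    Subtracting, [v' = x' - mu * conj x' * v^2] ([difference_equation]), and
    taking the real part of [v' * conj v] gives the linear equation
    [g' = - 2 * mu * Re (x' * conj v) * g] for [g = 1 - mu * |v|^2]
    ([defect_equation]).  By uniqueness ([linear_ode_unique]) [g] vanishes on
    all of [I] once it vanishes at one point, which is the [<-] direction.

    For [->], [|mu| * |v|^2 = 1] is the wanted equality as soon as [mu > 0].
    If [mu < 0], then [g = 2] is constant, so the linear equation forces
    [Re (x' * conj v) = 0].  Together with [mu * |v|^2 = -1] this turns the
    equation for [v] into [v' * conj v = 2 * Re (x' * conj v) = 0]; then [v] is
    constant and [xhat] is a translate of [x], the excluded configuration. *)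

(** * Continuity and derivatives relative to an interval *)

Lemma continuous_on_plus (I : R -> Prop) (f g : R -> R) :
  continuous_on I f -> continuous_on I g ->
  continuous_on I (fun t => f t + g t).
Proof.
  intros hf hg s hs.
  exact (filterlim_comp_2 f g Rplus (hf s hs) (hg s hs)
           (@filterlim_plus R_AbsRing R_NormedModule (f s) (g s))).
Qed.

Lemma continuous_on_mult (I : R -> Prop) (f g : R -> R) :
  continuous_on I f -> continuous_on I g ->
  continuous_on I (fun t => f t * g t).
Proof.
  intros hf hg s hs.
  exact (filterlim_comp_2 f g Rmult (hf s hs) (hg s hs)
           (@filterlim_mult R_AbsRing (f s) (g s))).
Qed.

Lemma continuous_on_const (I : R -> Prop) (c : R) :
  continuous_on I (fun _ : R => c).
Proof. intros s _; apply filterlim_const. Qed.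

Lemma continuous_on_minus (I : R -> Prop) (f g : R -> R) :
  continuous_on I f -> continuous_on I g ->
  continuous_on I (fun t => f t - g t).
Proof.
  intros hf hg.
  apply continuous_on_ext with (f := fun t => f t + -1 * g t);
    [intros t _; change (f t + -1 * g t = f t - g t); ring |].
  apply continuous_on_plus; [assumption |].
  apply continuous_on_mult; [apply continuous_on_const | assumption].
Qed.

Lemma ex_derive_on_continuous (I : R -> Prop) (x : R -> C) :
  (forall s, I s -> ex_derive_on I x s) ->
  continuous_on I (fun t => fst (x t)) /\ continuous_on I (fun t => snd (x t)).
Proof.
  intros h.
  assert (hc : forall s, I s ->
    filterlim x (within I (locally s))
      (@locally (NormedModule.UniformSpace _ C_R_NormedModule) (x s))).
  { intros s hs; destruct (h s hs) as [l hl].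
    apply (filterdiff_continuous_aux (U := R_NormedModule) x).
    - eexists; exact hl.
    - intros P hP; unfold within; revert hP; apply filter_imp; auto. }
  split; intros s hs.
  - apply (filterlim_comp _ _ _ x fst _ _ _ (hc s hs)).
    destruct (x s) as [u v].
    exact (continuous_fst (U := R_UniformSpace) (V := R_UniformSpace) u v).
  - apply (filterlim_comp _ _ _ x snd _ _ _ (hc s hs)).
    destruct (x s) as [u v].
    exact (continuous_snd (U := R_UniformSpace) (V := R_UniformSpace) u v).
Qed.

Lemma is_derive_on_interior (I : R -> Prop) (x : R -> C) (s : R) (l : C) :
  locally s I -> is_derive_on I x s l ->
  is_derive (fun t => fst (x t)) s (fst l) /\
  is_derive (fun t => snd (x t)) s (snd l).
Proof.
  intros hI [hlin hdom].
  assert (hd : @is_derive R_AbsRing C_R_NormedModule x s l).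
  { split; [apply is_linear_scal_l |].
    intros y hy eps.
    assert (e : s = y)
      by exact (is_filter_lim_locally_unique (V := R_NormedModule) s y hy).
    subst y.
    assert (hlim : @is_filter_lim R_UniformSpace (within I (locally s)) s)
      by (intros P hP; unfold within; revert hP; apply filter_imp; auto).
    generalize (filter_and _ _ hI (hdom s hlim eps)).
    apply filter_imp; intros t [h1 h2]; exact (h2 h1). }
  split.
  - apply (filterdiff_comp x (fst : C_R_NormedModule -> R_NormedModule) _ fst hd).
    apply filterdiff_linear.
    exact (is_linear_fst (U := R_NormedModule) (V := R_NormedModule)).
  - apply (filterdiff_comp x (snd : C_R_NormedModule -> R_NormedModule) _ snd hd).
    apply filterdiff_linear.
    exact (is_linear_snd (U := R_NormedModule) (V := R_NormedModule)).
Qed.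

Lemma Derive_on_interior (I : R -> Prop) (x : R -> C) (s : R) :
  is_interval I -> smooth_on I x -> I s -> locally s I ->
  is_derive (fun t => fst (x t)) s (fst (Derive_on I x s)) /\
  is_derive (fun t => snd (x t)) s (snd (Derive_on I x s)).
Proof.
  intros hI hx hs hloc.
  apply (is_derive_on_interior I); [exact hloc |].
  destruct (hx 0%nat s hs) as [l hl].
  rewrite (Derive_on_unique I x s l hI hs hl); exact hl.
Qed.

Lemma locally_between (I : R -> Prop) (a b s : R) :
  is_connected I -> I a -> I b -> a < s < b -> locally s I.
Proof.
  intros hI ha hb [h1 h2].
  apply (locally_interval I s a b); simpl; auto.
  intros t h3 h4; apply (hI a b); [exact ha | exact hb | lra].
Qed.

(** * Uniqueness for a linear equation on an interval *)

Definition clamp (a b t : R) : R := Rmax a (Rmin b t).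

Lemma clamp_bounds (a b t : R) : a <= b -> a <= clamp a b t <= b.
Proof.
  intros h; unfold clamp; split; [apply Rmax_l |].
  apply Rmax_lub; [exact h | apply Rmin_l].
Qed.

Lemma clamp_id (a b t : R) : a <= t <= b -> clamp a b t = t.
Proof.
  intros h; unfold clamp; rewrite Rmin_right by lra; apply Rmax_right; lra.
Qed.

Lemma clamp_contracts (a b s t : R) :
  Rabs (clamp a b t - clamp a b s) <= Rabs (t - s).
Proof.
  unfold clamp, Rmax, Rmin, Rabs.
  repeat destruct (Rle_dec _ _); repeat destruct (Rcase_abs _); lra.
Qed.

(** Precomposing with [clamp a b] turns continuity relative to [I], which is
    one-sided at an end point, into continuity on the whole line, and keeps the
    values between [a] and [b]. *)
Lemma continuous_on_clamp (I : R -> Prop) (f : R -> R) (a b : R) :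
  is_connected I -> I a -> I b -> a <= b -> continuous_on I f ->
  forall t, continuous (fun u => f (clamp a b u)) t.
Proof.
  intros hI ha hb hab hf t.
  assert (hin : forall u, I (clamp a b u))
    by (intros u; apply (hI a b); auto using clamp_bounds).
  apply (filterlim_comp _ _ _ (clamp a b) f _
           (within I (locally (clamp a b t))) _); [| apply hf, hin].
  intros P [d hd]; exists d; intros u hu.
  apply hd; [| apply hin].
  apply Rle_lt_trans with (2 := hu), clamp_contracts.
Qed.

(** With [A] a primitive of the coefficient, [f * exp (- A)] has zero
    derivative, hence keeps its initial value [0]. *)
Lemma linear_ode_unique (I : R -> Prop) (a f : R -> R) (s0 : R) :
  is_connected I -> I s0 ->
  continuous_on I a -> continuous_on I f ->
  (forall s, I s -> locally s I -> is_derive f s (a s * f s)) ->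
  f s0 = 0 -> forall s, I s -> f s = 0.
Proof.
  intros hI h0 hca hcf hd hf0 s hs.
  set (lo := Rmin s0 s); set (hi := Rmax s0 s).
  assert (hle : lo <= hi)
    by (apply Rle_trans with s0; [apply Rmin_l | apply Rmax_l]).
  assert (hlo : I lo) by (unfold lo, Rmin; destruct (Rle_dec _ _); auto).
  assert (hhi : I hi) by (unfold hi, Rmax; destruct (Rle_dec _ _); auto).
  assert (h0b : lo <= s0 <= hi) by (split; [apply Rmin_l | apply Rmax_l]).
  assert (hsb : lo <= s <= hi) by (split; [apply Rmin_r | apply Rmax_r]).
  set (b := fun u => a (clamp lo hi u)).
  set (F := fun u => f (clamp lo hi u)).
  set (A := fun u => RInt b s0 u).
  assert (hcb : forall t, continuous b t)
    by exact (continuous_on_clamp I a lo hi hI hlo hhi hle hca).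
  assert (hcF : forall t, continuous F t)
    by exact (continuous_on_clamp I f lo hi hI hlo hhi hle hcf).
  assert (hA : forall t, is_derive A t (b t)).
  { intros t; apply is_derive_RInt with s0; [| apply hcb].
    apply filter_forall; intros u.
    apply (RInt_correct (V := R_CompleteNormedModule)), ex_RInt_continuous; auto. }
  set (G := fun u => F u * exp (- A u)).
  destruct (MVT_gen G s0 s (fun _ => 0)) as [c [_ hc]].
  - intros t ht; change (lo < t < hi) in ht.
    assert (hF : is_derive F t (b t * F t)).
    { unfold b, F; rewrite clamp_id by lra.
      apply is_derive_ext_loc with f.
      - apply (locally_interval _ t lo hi); simpl; try apply ht.
        intros u h1 h2; rewrite clamp_id; lra.
      - apply hd; [apply (hI lo hi); auto; lra |].
        apply (locally_between I lo hi); auto. }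
    unfold G; auto_derive.
    + split; [eexists; exact hF | split; [eexists; exact (hA t) | exact Logic.I]].
    + rewrite (is_derive_unique (fun u : R => F u) _ _ hF).
      rewrite (is_derive_unique (fun u : R => A u) _ _ (hA t)); ring.
  - intros t _; apply continuity_pt_filterlim.
    apply (continuous_mult (K := R_AbsRing) F); [apply hcF |].
    apply (continuous_comp (fun u => - A u) exp).
    + apply (continuous_opp (V := R_NormedModule) A).
      apply (ex_derive_continuous (V := R_NormedModule)); eexists; exact (hA t).
    + apply continuity_pt_filterlim, derivable_continuous_pt, derivable_pt_exp.
  - unfold G, F in hc; rewrite !clamp_id, hf0 in hc by assumption.
    assert (hp := exp_pos (- A s)); nra.
Qed.

Lemma constant_of_zero_derivative (I : R -> Prop) (f : R -> R) :
  is_connected I -> continuous_on I f ->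
  (forall s, I s -> locally s I -> is_derive f s 0) ->
  forall s t, I s -> I t -> f s = f t.
Proof.
  intros hI hc hd s t hs ht.
  apply Rminus_diag_uniq.
  apply (linear_ode_unique I (fun _ => 0) (fun u => f u - f t) t);
    auto using continuous_on_const, continuous_on_minus; [| ring].
  intros u hu hl; specialize (hd u hu hl).
  auto_derive; [eexists; exact hd |].
  rewrite (is_derive_unique (fun u : R => f u) _ _ hd); ring.
Qed.

(** * The Darboux equation in arc length *)

Lemma Cmod_sqr (z : C) : Cmod z ^ 2 = fst z ^ 2 + snd z ^ 2.
Proof.
  unfold Cmod; rewrite pow2_sqrt; [reflexivity |].
  assert (h1 := pow2_ge_0 (fst z)); assert (h2 := pow2_ge_0 (snd z)); lra.
Qed.

(** Arc length makes [mu / m] equal to [mu * x' * conj x'] and keeps [x'] away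
    from [0], so [x'] cancels. *)
Lemma Darboux_derivative (I : R -> Prop) (m : R -> R) (mu : R) (x xhat : R -> C) :
  Darboux_pair I m mu x xhat -> arc_length_polarization I m x ->
  forall s, I s ->
  Derive_on I xhat s =
    (RtoC mu * Cconj (Derive_on I x s) * ((x s - xhat s) * (x s - xhat s)))%C.
Proof.
  intros [[_ hm] [_ [_ hD]]] hx s hs.
  destruct (hD s hs) as [hne he]; specialize (hx s hs); specialize (hm s hs).
  set (u := Derive_on I x s) in *; set (w := Derive_on I xhat s) in *.
  set (v := (x s - xhat s)%C) in *.
  assert (hv : v <> 0%C).
  { intros h; apply hne; replace (x s) with (v + xhat s)%C by (unfold v; ring).
    rewrite h; ring. }
  assert (hu : u <> 0%C).
  { intros h; rewrite h, Cmod_0 in hx.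
    assert (h1 : 1 = 1 / m s * m s) by (field; exact hm).
    rewrite hx in h1; lra. }
  replace (mu / m s) with (mu * (Cmod u ^ 2)) in he
    by (rewrite <- hx; field; exact hm).
  rewrite RtoC_mult, Cmod2_conj in he.
  replace w with (u * w / (v * v) * (v * v) / u)%C by (field; auto).
  rewrite he; field; exact hu.
Qed.

Lemma Darboux_speed (I : R -> Prop) (m : R -> R) (mu : R) (x xhat : R -> C) :
  Darboux_pair I m mu x xhat -> arc_length_polarization I m x ->
  forall s, I s ->
  (1 / m s = Cmod (Derive_on I xhat s) ^ 2 <->
   (mu * Cmod (x s - xhat s) ^ 2) ^ 2 = 1).
Proof.
  intros hD hx s hs.
  rewrite (Darboux_derivative I m mu x xhat hD hx s hs).
  rewrite !Cmod_mult, Cmod_conj, Cmod_R.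
  destruct hD as [[_ hm] _]; specialize (hm s hs).
  assert (hn : 1 / m s <> 0)
    by (intros h; apply (Rinv_neq_0_compat _ hm); lra).
  assert (hmu : Rabs mu ^ 2 = mu ^ 2) by apply pow2_abs.
  set (d := Cmod (x s - xhat s)).
  replace ((Rabs mu * Cmod (Derive_on I x s) * (d * d)) ^ 2)
    with (Rabs mu ^ 2 * d ^ 4 * Cmod (Derive_on I x s) ^ 2) by ring.
  rewrite hmu, <- (hx s hs).
  split; intros h.
  - apply Rmult_eq_reg_r with (2 := hn); lra.
  - replace (mu ^ 2 * d ^ 4) with ((mu * d ^ 2) ^ 2) by ring; rewrite h; ring.
Qed.

(** The equation [v' = x' - mu * conj x' * v^2] in coordinates. *)
Lemma difference_equation (I : R -> Prop) (m : R -> R) (mu : R) (x xhat : R -> C) :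
  is_interval I ->
  Darboux_pair I m mu x xhat -> arc_length_polarization I m x ->
  forall s, I s -> locally s I ->
  let a := fst (Derive_on I x s) in let b := snd (Derive_on I x s) in
  let p := fst (x s - xhat s)%C in let q := snd (x s - xhat s)%C in
  is_derive (fun t => fst (x t - xhat t)%C) s
    (a - mu * (a * (p ^ 2 - q ^ 2) + 2 * b * p * q)) /\
  is_derive (fun t => snd (x t - xhat t)%C) s
    (b - mu * (2 * a * p * q - b * (p ^ 2 - q ^ 2))).
Proof.
  intros hI hD hx s hs hl a b p q.
  assert (hw := Darboux_derivative I m mu x xhat hD hx s hs).
  destruct hD as [[hsx _] [[hsh _] _]].
  destruct (Derive_on_interior I x s hI hsx hs hl) as [h1 h2].
  destruct (Derive_on_interior I xhat s hI hsh hs hl) as [k1 k2].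
  rewrite hw in k1, k2.
  split.
  - replace (a - _) with (minus (fst (Derive_on I x s))
      (fst (RtoC mu * Cconj (Derive_on I x s) *
              ((x s - xhat s) * (x s - xhat s)))%C)).
    + exact (is_derive_minus _ _ s _ _ h1 k1).
    + unfold minus, plus, opp, a, b, p, q; simpl; ring.
  - replace (b - _) with (minus (snd (Derive_on I x s))
      (snd (RtoC mu * Cconj (Derive_on I x s) *
              ((x s - xhat s) * (x s - xhat s)))%C)).
    + exact (is_derive_minus _ _ s _ _ h2 k2).
    + unfold minus, plus, opp, a, b, p, q; simpl; ring.
Qed.

(** This is [Re (x' * conj (x - xhat))], the derivative that
    [|x - xhat|^2 / 2] would have if only the point [x] were moving. *)
Definition radial_speed (I : R -> Prop) (x xhat : R -> C) (s : R) : R :=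
  fst (Derive_on I x s) * fst (x s - xhat s)%C +
  snd (Derive_on I x s) * snd (x s - xhat s)%C.

(** The real part of [v' * conj v] is [Re (x' * conj v) * (1 - mu * |v|^2)],
    because [conj x' * v] and [x' * conj v] have the same real part. *)
Lemma defect_equation (I : R -> Prop) (m : R -> R) (mu : R) (x xhat : R -> C) :
  is_interval I ->
  Darboux_pair I m mu x xhat -> arc_length_polarization I m x ->
  forall s, I s -> locally s I ->
  is_derive (fun t => 1 - mu * Cmod (x t - xhat t) ^ 2) s
    (- 2 * mu * radial_speed I x xhat s *
       (1 - mu * Cmod (x s - xhat s) ^ 2)).
Proof.
  intros hI hD hx s hs hl.
  destruct (difference_equation I m mu x xhat hI hD hx s hs hl) as [hp hq].
  apply is_derive_ext with
    (fun t => 1 - mu * (fst (x t - xhat t)%C ^ 2 + snd (x t - xhat t)%C ^ 2)).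
  { intros t; rewrite Cmod_sqr; reflexivity. }
  rewrite Cmod_sqr; unfold radial_speed.
  revert hp hq.
  set (p := fun t => fst (x t - xhat t)%C); set (q := fun t => snd (x t - xhat t)%C).
  change (fst (x s - xhat s)%C) with (p s); change (snd (x s - xhat s)%C) with (q s).
  intros hp hq.
  change (is_derive (fun t => 1 - mu * (p t ^ 2 + q t ^ 2)) s
    (- 2 * mu * (fst (Derive_on I x s) * p s + snd (Derive_on I x s) * q s) *
       (1 - mu * (p s ^ 2 + q s ^ 2)))).
  auto_derive.
  - split; [eexists; exact hp | split; [eexists; exact hq | exact Logic.I]].
  - rewrite (is_derive_unique (fun t : R => p t) _ _ hp).
    rewrite (is_derive_unique (fun t : R => q t) _ _ hq); ring.
Qed.

Lemma difference_continuous (I : R -> Prop) (x xhat : R -> C) :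
  smooth_on I x -> smooth_on I xhat ->
  continuous_on I (fun t => fst (x t - xhat t)%C) /\
  continuous_on I (fun t => snd (x t - xhat t)%C).
Proof.
  intros h k.
  destruct (ex_derive_on_continuous I x (h 0%nat)) as [h1 h2].
  destruct (ex_derive_on_continuous I xhat (k 0%nat)) as [k1 k2].
  split; [exact (continuous_on_minus I _ _ h1 k1)
         | exact (continuous_on_minus I _ _ h2 k2)].
Qed.

Lemma radial_speed_continuous (I : R -> Prop) (x xhat : R -> C) :
  smooth_on I x -> smooth_on I xhat -> continuous_on I (radial_speed I x xhat).
Proof.
  intros h k.
  destruct (difference_continuous I x xhat h k).
  destruct (ex_derive_on_continuous I (Derive_on I x) (h 1%nat)).
  apply continuous_on_plus; apply continuous_on_mult; assumption.
Qed.

Lemma defect_propagates (I : R -> Prop) (m : R -> R) (mu : R) (x xhat : R -> C)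
    (s0 : R) :
  is_interval I ->
  Darboux_pair I m mu x xhat -> arc_length_polarization I m x ->
  I s0 -> mu * Cmod (x s0 - xhat s0) ^ 2 = 1 ->
  forall s, I s -> mu * Cmod (x s - xhat s) ^ 2 = 1.
Proof.
  intros hI hD hx h0 he s hs.
  assert (hs2 : smooth_on I x /\ smooth_on I xhat)
    by (destruct hD as [[h _] [[k _] _]]; auto).
  destruct hs2 as [hsx hsh].
  destruct (difference_continuous I x xhat hsx hsh) as [cp cq].
  symmetry; apply Rminus_diag_uniq.
  apply (linear_ode_unique I (fun t => -2 * mu * radial_speed I x xhat t)
           (fun t => 1 - mu * Cmod (x t - xhat t) ^ 2) s0);
    [apply hI | exact h0 | | | | lra | exact hs].
  - apply continuous_on_mult;
      [apply continuous_on_const | apply radial_speed_continuous; assumption].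
  - apply continuous_on_minus; [apply continuous_on_const |].
    apply continuous_on_mult; [apply continuous_on_const |].
    apply continuous_on_ext with
      (f := fun t => fst (x t - xhat t)%C * fst (x t - xhat t)%C +
                     snd (x t - xhat t)%C * snd (x t - xhat t)%C).
    + intros t _; rewrite Cmod_sqr.
      match goal with |- ?u = ?v => change (@eq R u v) end; ring.
    + apply continuous_on_plus; apply continuous_on_mult; assumption.
  - exact (defect_equation I m mu x xhat hI hD hx).
Qed.

(** If [mu * |v|^2 = -1] then [1 - mu * |v|^2 = 2] is constant and nonzero, so
    the radial speed vanishes; the equation for [v] then reads [v' = 0]. *)
Lemma negative_constant_distance_translate (I : R -> Prop) (m : R -> R) (mu : R)
    (x xhat : R -> C) :
  is_interval I ->
  Darboux_pair I m mu x xhat -> arc_length_polarization I m x ->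
  (forall s, I s -> mu * Cmod (x s - xhat s) ^ 2 = -1) ->
  translate_on I x xhat.
Proof.
  intros hI hD hx hc.
  assert (hs2 : smooth_on I x /\ smooth_on I xhat)
    by (destruct hD as [[h _] [[k _] _]]; auto).
  destruct hs2 as [hsx hsh].
  destruct (difference_continuous I x xhat hsx hsh) as [cp cq].
  assert (hmu : mu <> 0) by apply hD.
  assert (hr : forall s, I s -> locally s I -> radial_speed I x xhat s = 0).
  { intros s hs hl.
    assert (h1 := defect_equation I m mu x xhat hI hD hx s hs hl).
    assert (h2 : is_derive (fun t => 1 - mu * Cmod (x t - xhat t) ^ 2) s 0).
    { apply is_derive_ext_loc with (fun _ => 2).
      - revert hl; apply filter_imp; intros t ht; rewrite (hc t ht).
        change (2 = 1 - -1); ring.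
      - apply (is_derive_const (V := R_NormedModule)). }
    rewrite (hc s hs) in h1.
    assert (h3 := is_derive_unique _ _ _ h1).
    rewrite (is_derive_unique _ _ _ h2) in h3.
    apply Rmult_eq_reg_l with (2 := hmu); lra. }
  assert (hz : forall s, I s -> locally s I ->
    is_derive (fun t => fst (x t - xhat t)%C) s 0 /\
    is_derive (fun t => snd (x t - xhat t)%C) s 0).
  { intros s hs hl.
    destruct (difference_equation I m mu x xhat hI hD hx s hs hl) as [hp hq].
    specialize (hr s hs hl); specialize (hc s hs).
    unfold radial_speed in hr; rewrite Cmod_sqr in hc.
    revert hp hq hr hc.
    generalize (fst (Derive_on I x s)) (snd (Derive_on I x s)).
    generalize (fst (x s - xhat s)%C) (snd (x s - xhat s)%C).
    intros p q a b hp hq hr hc.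
    (* Both derivatives are combinations of [a * p + b * q] and
       [1 + mu * (p ^ 2 + q ^ 2)], which vanish. *)
    replace (a - mu * _) with
      (a * (1 + mu * (p ^ 2 + q ^ 2)) - 2 * mu * p * (a * p + b * q)) in hp
      by ring.
    replace (b - mu * _) with
      (b * (1 + mu * (p ^ 2 + q ^ 2)) - 2 * mu * q * (a * p + b * q)) in hq
      by ring.
    rewrite hr, hc in hp, hq.
    replace (a * _ - _) with 0 in hp by ring.
    replace (b * _ - _) with 0 in hq by ring.
    split; assumption. }
  destruct hI as [hconn [s1 [_ [h1 _]]]].
  exists (xhat s1 - x s1)%C; intros s hs.
  assert (ep := constant_of_zero_derivative I _ hconn cp
                  (fun s hs hl => proj1 (hz s hs hl)) s s1 hs h1).
  assert (eq := constant_of_zero_derivative I _ hconn cq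
                  (fun s hs hl => proj2 (hz s hs hl)) s s1 hs h1).
  simpl in ep, eq.
  apply injective_projections; simpl; lra.
Qed.

Theorem proposition2p8 (I : R -> Prop) (hI : is_interval I)
    (m : R -> R) (mu : R) (x xhat : R -> C)
    (hD : Darboux_pair I m mu x xhat)
    (hx : arc_length_polarization I m x)
    (hdeg : ~ (mu < 0 /\ translate_on I x xhat)) :
  arc_length_polarization I m xhat <->
  exists s0 : R, I s0 /\ Cmod (xhat s0 - x s0) ^ 2 = 1 / mu.
Proof.
  assert (hmu : mu <> 0) by apply hD.
  assert (hsym : forall s, Cmod (xhat s - x s) = Cmod (x s - xhat s)).
  { intros s; rewrite <- Cmod_opp; f_equal; ring. }
  split.
  - intros hhat.
    assert (hsq : forall s, I s -> (mu * Cmod (x s - xhat s) ^ 2) ^ 2 = 1)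
      by (intros s hs; apply (Darboux_speed I m mu x xhat hD hx s hs), hhat, hs).
    destruct (Rtotal_order mu 0) as [hneg | [h0 | hpos]];
      [exfalso | contradiction |].
    + apply hdeg; split; [exact hneg |].
      apply (negative_constant_distance_translate I m mu); auto.
      intros s hs; specialize (hsq s hs).
      assert (h2 := pow2_ge_0 (Cmod (x s - xhat s))).
      assert (h3 : mu * Cmod (x s - xhat s) ^ 2 <= 0) by nra.
      revert hsq h3; generalize (mu * Cmod (x s - xhat s) ^ 2); intros; nra.
    + destruct (proj2 hI) as [s0 [_ [hs _]]].
      exists s0; split; [exact hs |]; specialize (hsq s0 hs).
      rewrite hsym.
      assert (h2 := pow2_ge_0 (Cmod (x s0 - xhat s0))).
      apply Rmult_eq_reg_l with (2 := hmu).
      replace (mu * (1 / mu)) with 1 by (field; exact hmu).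
      assert (h3 : 0 <= mu * Cmod (x s0 - xhat s0) ^ 2) by nra.
      revert hsq h3; generalize (mu * Cmod (x s0 - xhat s0) ^ 2); intros; nra.
  - intros [s0 [h0 he]] s hs.
    apply (Darboux_speed I m mu x xhat hD hx s hs).
    rewrite (defect_propagates I m mu x xhat s0 hI hD hx h0); [ring | | exact hs].
    rewrite <- hsym, he; field; exact hmu.
Qed.
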